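(* Let $T_\ell$ denote the degree-$\ell$ Chebyshev polynomial of the first kind. For every integer $n\ge 1$, the following holds as an algebraic identity (i.e. an identity of rational functions in $x$): $$ \sum_{i=1}^n \frac{2^i}{T_i(x)+1}\; \prod_{\ell=0}^{i-1} C_{\ell,i}(x)\, \frac{\big(T_{\ell}(x)\big)^2 - \big(T_{n}(x)\big)^2}{\big( T_{\ell}(x) + 1 \big)^2} \;=\; \frac{1-T_n(x)}{2T_n(x)}, $$ where, for $i=1,\ldots,n$ and $\ell=0,\ldots,i-1$, $$ C_{\ell,i}(x) \;=\; \frac{ \big( T_{\ell}(x) - T_{\ell+1}(x) \big)\, \big( T_{\ell}(x)+1 \big)}{\big( T_{i}(x) - T_{i+1}(x) \big) - \big( T_{\ell}(x) - T_{\ell+1}(x) \big)} . $$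
   Context: In the summand, the product over $\ell$ from $0$ to $i-1$ is taken of the whole expression $C_{\ell,i}(x)\,\frac{(T_\ell(x))^2-(T_n(x))^2}{(T_\ell(x)+1)^2}$. The identity is to be understood algebraically, since the two sides may fail to be well-defined for some particular values of $x$. *)

(* Defs.v *)
From HB Require Import structures.
From mathcomp Require Import all_boot all_order all_algebra.

Set Implicit Arguments.
Unset Strict Implicit.
Unset Printing Implicit Defensive.

Import Order.TTheory GRing.Theory Num.Theory.

Local Open Scope ring_scope.

Fixpoint chebyshevT (R : nzRingType) (n : nat) : {poly R} :=
  match n with
  | 0 => 1
  | n'.+1 =>
    match n' with
    | 0 => 'X
    | n''.+1 => 2 *: ('X * chebyshevT R n') - chebyshevT R n''
    end
  end.

(* Identities between rational functions in x are equalities in the fraction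
   field of {poly F}, where x is the image of 'X. *)
Definition chebT (F : fieldType) (n : nat) : {fraction {poly F}} :=
  FracField.tofrac (chebyshevT F n).

(* In characteristic 0 the denominator is nonzero for l < i, the leading
   term being that of T_{i+1}. *)
Definition chebC (F : fieldType) (l i : nat) : {fraction {poly F}} :=
  ((chebT F l - chebT F l.+1) * (chebT F l + 1)) /
  ((chebT F i - chebT F i.+1) - (chebT F l - chebT F l.+1)).

(* Main.v *)
(* Write x = (z + 1/z)/2 with z in an extension of the field of rational
   functions, so that T_l = (z^l + z^-l)/2.  Then
     T_l - T_(l+1) = (z - 1) (1 - z^(2l+1)) / (2 z^(l+1)),
     T_l^2 - T_n^2 = (1 - z^(2l+2n)) (1 - z^(2l-2n)) / (4 z^(2l)),
   and the denominators of the C_(l,i) factor as well, so that the i-th summand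
   is half the i-th term of the basic hypergeometric series in base q = z^2
     3phi2 (z, q^n, q^-n; -z, -q; q, q).
   The case i = 0 contributes 1/2, and the whole series sums to 1/T_n: it is an
   instance of the q-Pfaff-Saalschuetz formula, proved here by
   Wilf-Zeilberger telescoping in n. *)
Require Import Defs.
From mathcomp Require Import all_boot all_order all_algebra.
From mathcomp Require Import fieldext ring.
From Stdlib Require Import Classical_Prop.

Set Implicit Arguments.
Unset Strict Implicit.
Unset Printing Implicit Defensive.

Import Order.TTheory GRing.Theory Num.Theory.

Local Open Scope ring_scope.

(** * Summation of the 3phi2 series when z is not a root of unity *)

Section NotRootOfUnity.
Variables (K : fieldType) (z : K).
Hypotheses (two_neq0 : 2 != 0 :> K) (z_neq0 : z != 0).
Hypothesis z_not_unity : forall m, (0 < m)%N -> z ^+ m != 1.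

Definition cosz l : K := (z ^+ l + (z ^+ l)^-1) / 2.

(** With q = z^2, the part of the ratio of consecutive 3phi2 terms that does not involve n. *)
Definition saalCoef l : K :=
  z ^+ 2 * (1 - z * (z ^+ l) ^+ 2)
  / ((1 - z ^+ 2 * (z ^+ l) ^+ 2) * (1 + z * (z ^+ l) ^+ 2)
     * (1 + z ^+ 2 * (z ^+ l) ^+ 2)).

(* Ratio of the terms l.+1 and l of the 3phi2 series. *)
Definition saalFactor n l : K :=
  saalCoef l * ((1 - (z ^+ l) ^+ 2 * (z ^+ n) ^+ 2)
                * (1 - (z ^+ l) ^+ 2 / (z ^+ n) ^+ 2)).

Lemma subr1X_neq0 m : (0 < m)%N -> 1 - z ^+ m != 0.
Proof. by move=> m_gt0; rewrite subr_eq0 eq_sym z_not_unity. Qed.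

Lemma addr1X_neq0 m : 1 + z ^+ m != 0.
Proof.
case: m => [|m]; first by rewrite expr0.
apply/negP => /eqP e; have /negP[] := @z_not_unity (m.+1 * 2)%N isT.
have -> : z ^+ (m.+1 * 2) = 1 + (z ^+ m.+1 - 1) * (1 + z ^+ m.+1).
  by rewrite exprM; ring.
by rewrite e mulr0 addr0.
Qed.

Lemma saalDenominators_neq0 l :
  [/\ 1 - z ^+ 2 * (z ^+ l) ^+ 2 != 0, 1 + z * (z ^+ l) ^+ 2 != 0
    & 1 + z ^+ 2 * (z ^+ l) ^+ 2 != 0].
Proof.
rewrite -exprM -exprD -exprS.
by split; rewrite ?subr1X_neq0 ?addr1X_neq0.
Qed.

(* The products of saalFactor n and saalFactor n.+1 have this one as a common
   part, which vanishes for l = n, where the telescoped sum stops. *)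
Definition certFactor n l : K :=
  saalCoef l * ((1 - (z ^+ l) ^+ 2 * (z ^+ n.+1) ^+ 2)
                * (1 - (z ^+ l) ^+ 2 / (z ^+ n) ^+ 2)).

Lemma zX_neq0 j : z ^+ j != 0.
Proof. exact: expf_neq0. Qed.

(** Shifting l by one turns the factors 1 - q^(l+n) into those of [certFactor n], so that only
    boundary factors stay outside. In [prod_saalFactorS] the factors 1 - q^(l-n-1) are shifted
    instead. *)
Lemma prod_saalFactor n k :
  \prod_(l < k.+1) saalFactor n l =
  saalCoef k * (1 - (z ^+ n) ^+ 2) * (1 - (z ^+ k) ^+ 2 / (z ^+ n) ^+ 2)
  * \prod_(l < k) certFactor n l.
Proof.
elim: k => [|k IHk].
  rewrite big_ord_recr !big_ord0 /= /saalFactor expr0.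
  by field; rewrite zX_neq0.
rewrite big_ord_recr IHk big_ord_recr /= /saalFactor /certFactor !exprS.
by field; rewrite zX_neq0.
Qed.

Lemma prod_saalFactorS n k :
  \prod_(l < k.+1) saalFactor n.+1 l =
  saalCoef k * (1 - ((z ^+ n.+1) ^+ 2)^-1)
  * (1 - (z ^+ k) ^+ 2 * (z ^+ n.+1) ^+ 2)
  * \prod_(l < k) certFactor n l.
Proof.
elim: k => [|k IHk].
  rewrite big_ord_recr !big_ord0 /= /saalFactor expr0.
  by field; rewrite zX_neq0.
rewrite big_ord_recr IHk big_ord_recr /= /saalFactor /certFactor !exprS.
by field; rewrite zX_neq0 z_neq0.
Qed.

(** With F(n,i) = T_n times the i-th term, the right-hand side is the Wilf-Zeilberger companion: its
    increment from k to k+1 is F(n+1,k+1) - F(n,k+1). *)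
Lemma saal_telescope n k :
  \sum_(i < k.+1) (cosz n.+1 * \prod_(l < i) saalFactor n.+1 l
                   - cosz n * \prod_(l < i) saalFactor n l) =
  ((z ^+ n.+1)^-1 - z ^+ n) / 2 * (1 - z * (z ^+ k) ^+ 2)
  / (z ^+ k) ^+ 2 * \prod_(l < k) certFactor n l.
Proof.
elim: k => [|k IHk].
  rewrite big_ord1 !big_ord0 /cosz !exprS !expr0.
  by field; rewrite oner_neq0 two_neq0 zX_neq0 z_neq0.
rewrite big_ord_recr IHk /= prod_saalFactorS prod_saalFactor big_ord_recr /=.
rewrite /certFactor /saalCoef /cosz !exprS.
have [] := saalDenominators_neq0 k; rewrite !expr2 => h1 h2 h3.
by field; rewrite two_neq0 !zX_neq0 z_neq0 h1 h2 h3.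
Qed.

Lemma saal_sum n :
  cosz n * \sum_(i < n.+1) \prod_(l < i) saalFactor n l = 1.
Proof.
elim: n => [|n IHn].
  by rewrite big_ord1 !big_ord0 /cosz expr0; field; rewrite oner_neq0 two_neq0.
have := saal_telescope n n.+1.
rewrite [X in _ = _ * X]big_ord_recr /= /certFactor divff ?expf_neq0 // subrr !mulr0.
rewrite sumrB -!mulr_sumr => /eqP; rewrite subr_eq0 => /eqP ->.
(* The sum for n has one term too many here; it vanishes because [saalFactor n n] is 0. *)
rewrite big_ord_recr /= [X in _ + X]big_ord_recr /= /saalFactor.
by rewrite divff ?expf_neq0 // subrr !mulr0 addr0.
Qed.

(** * Chebyshev summands as terms of the series *)

Lemma prod_addr1X i :
  \prod_(l < i) (1 + z ^+ (i + l.+1)) * \prod_(l < i) (1 + z ^+ l.+1) =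
  \prod_(l < i) ((1 + z ^+ (2 * l).+1) * (1 + z ^+ (2 * l).+2)).
Proof.
(* Both sides are the product of 1 + z^m for 1 <= m <= 2i, cut into halves or grouped in consecutive
   pairs. *)
have -> : \prod_(l < i) ((1 + z ^+ (2 * l).+1) * (1 + z ^+ (2 * l).+2)) =
    \prod_(l < i + i) (1 + z ^+ l.+1).
  elim: i => [|i IHi]; first by rewrite !big_ord0.
  by rewrite addSn addnS !big_ord_recr IHi /= -mulrA mul2n addnn.
rewrite big_split_ord /= mulrC; congr (_ * _).
by apply: eq_bigr => l _; rewrite addnS.
Qed.

(** Up to a constant and a power of z, the denominator of C_(l,i) is (1 - z)(1 - z^(i-l))(1 +
    z^(i+l+1)), and 1 - z cancels against T_l - T_(l+1). The dependence on i is thus confined to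
    functions of i - l and i + l + 1. *)
Lemma cheb_factorE n i l : (l < i)%N ->
  (cosz l - cosz l.+1) * (cosz l + 1)
    / ((cosz i - cosz i.+1) - (cosz l - cosz l.+1))
    * ((cosz l ^+ 2 - cosz n ^+ 2) / (cosz l + 1) ^+ 2) =
  z ^+ (i - l) / (1 - z ^+ (i - l)) / (1 + z ^+ (i + l.+1))
  * ((1 - z * (z ^+ l) ^+ 2) / (2 * (z ^+ l) * (1 + z ^+ l) ^+ 2)
  * ((1 - (z ^+ l) ^+ 2 * (z ^+ n) ^+ 2) * (1 - (z ^+ l) ^+ 2 / (z ^+ n) ^+ 2))).
Proof.
move=> lti; have [d ->] : exists d, i = (l + d.+1)%N.
  by exists (i - l).-1; rewrite prednK ?subn_gt0 // subnKC // ltnW.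
rewrite addKn /cosz.
have hd := @subr1X_neq0 d.+1 isT.
have hl := addr1X_neq0 l.
have h1 := @subr1X_neq0 1 isT.
have hs := addr1X_neq0 (l + d.+1 + l.+1).
have e1 : z ^+ (l + d.+1) = z ^+ l * z ^+ d.+1 by rewrite exprD.
have e2 : z ^+ (l + d.+1 + l.+1) = z * (z ^+ l) ^+ 2 * z ^+ d.+1.
  by rewrite !exprD (exprS _ l); ring.
move: hd hl hs (zX_neq0 l) (zX_neq0 n) (zX_neq0 d.+1) h1.
rewrite e2 (exprS z (l + d.+1)) (exprS z l) e1; set D := z ^+ d.+1.
rewrite expr1 => *.
field.
repeat (apply/andP; split=> //).
- suff -> : z ^+ l * z ^+ l + 1 + z ^+ l * 2 = (1 + z ^+ l) ^+ 2 by rewrite expf_neq0.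
  by ring.
- set t := (X in X != 0); suff -> : t = - ((1 - z) * (1 - D) * (1 + z * z ^+ l ^+ 2 * D)).
    by rewrite oppr_eq0 !mulf_neq0.
  by rewrite /t; ring.
Qed.

Lemma cosz_add1E l : cosz l + 1 = (1 + z ^+ l) ^+ 2 / (2 * z ^+ l).
Proof. by rewrite /cosz; field; rewrite two_neq0 zX_neq0. Qed.

Lemma cosz_add1_neq0 l : cosz l + 1 != 0.
Proof.
by rewrite cosz_add1E mulf_neq0 ?invr_eq0 ?mulf_neq0 ?zX_neq0 ?expf_neq0 ?addr1X_neq0.
Qed.

(** The factor in front of the last product cancels the prefactor 2^i / (T_i + 1) of the summand and
    leaves 1/2. *)
Lemma prod_saalCoef i :
  \prod_(l < i) (z ^+ l.+1 / (1 - z ^+ l.+1)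
     * ((1 + z ^+ l.+1) / ((1 + z ^+ (2 * l).+1) * (1 + z ^+ (2 * l).+2)))
     * ((1 - z * (z ^+ l) ^+ 2) / (2 * (z ^+ l) * (1 + z ^+ l) ^+ 2))) =
  (cosz i + 1) / 2 ^+ i.+1 * \prod_(l < i) saalCoef l.
Proof.
elim: i => [|i IHi].
  by rewrite !big_ord0 /cosz expr0; field; rewrite oner_neq0 two_neq0.
rewrite !big_ord_recr /= IHi !cosz_add1E /saalCoef.
have e1 : z ^+ (2 * i).+1 = z * (z ^+ i) ^+ 2 by rewrite exprS mulnC exprM.
have e2 : z ^+ (2 * i).+2 = z ^+ 2 * (z ^+ i) ^+ 2 by rewrite exprS e1; ring.
have e3 : 1 - z ^+ 2 * (z ^+ i) ^+ 2 = (1 - z ^+ i.+1) * (1 + z ^+ i.+1).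
  by rewrite (exprS z i); ring.
move: (@subr1X_neq0 i.+1 isT) (addr1X_neq0 i.+1) (addr1X_neq0 i).
have [_ h2 h3] := saalDenominators_neq0 i; move: h2 h3.
rewrite e1 e2 e3 !(exprS z i) !(exprS 2) !expr2 => h2 h3 h4 h5 h6.
by field; rewrite h2 h3 h4 h5 h6 two_neq0 zX_neq0 z_neq0 expf_neq0.
Qed.

Lemma cheb_termE n i :
  2 ^+ i / (cosz i + 1) *
  \prod_(0 <= l < i)
    ((cosz l - cosz l.+1) * (cosz l + 1)
    / ((cosz i - cosz i.+1) - (cosz l - cosz l.+1))
    * ((cosz l ^+ 2 - cosz n ^+ 2) / (cosz l + 1) ^+ 2)) =
  (\prod_(l < i) saalFactor n l) / 2.
Proof.
rewrite big_mkord (eq_bigr _ (fun l _ => cheb_factorE n (ltn_ord l))).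
rewrite big_split /= [\prod_(l < i) (_ / _ / _)]big_split /=.
rewrite [\prod_(l < i) (_ / _ * (_ * _))]big_split /=.
(* Reversing this product, and applying [prod_addr1X] to the next one, removes i from the
   factors. *)
have -> : \prod_(l < i) (z ^+ (i - l) / (1 - z ^+ (i - l))) =
    \prod_(l < i) (z ^+ l.+1 / (1 - z ^+ l.+1)).
  rewrite (reindex_inj rev_ord_inj) /=; apply: eq_bigr => l _.
  by rewrite subKn.
have -> : \prod_(l < i) (1 + z ^+ (i + l.+1))^-1 =
    \prod_(l < i) ((1 + z ^+ l.+1) / ((1 + z ^+ (2 * l).+1) * (1 + z ^+ (2 * l).+2))).
  rewrite prodf_div prodfV -prod_addr1X.
  have h1 : \prod_(l < i) (1 + z ^+ (i + l.+1)) != 0.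
    by apply/prodf_neq0 => l _; apply: addr1X_neq0.
  have h2 : \prod_(l < i) (1 + z ^+ l.+1) != 0.
    by apply/prodf_neq0 => l _; apply: addr1X_neq0.
  by field; rewrite h1 h2.
have := prod_saalCoef i; rewrite big_split /= [\prod_(l < i) (_ / _ * (_ / _))]big_split /=.
move=> e; rewrite [in RHS]big_split /= [X in _ * X = _]mulrA e exprS.
by field; rewrite two_neq0 expf_neq0 //= cosz_add1_neq0.
Qed.

Lemma cosz_neq0 n : cosz n != 0.
Proof.
have -> : cosz n = (1 + z ^+ (n * 2)) / (2 * z ^+ n).
  by rewrite /cosz exprM; field; rewrite two_neq0 zX_neq0.
by rewrite mulf_neq0 ?invr_eq0 ?mulf_neq0 ?zX_neq0 ?addr1X_neq0.
Qed.

Lemma cosz_identity n :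
  \sum_(1 <= i < n.+1)
    2 ^+ i / (cosz i + 1) *
    \prod_(0 <= l < i)
      ((cosz l - cosz l.+1) * (cosz l + 1)
      / ((cosz i - cosz i.+1) - (cosz l - cosz l.+1))
      * ((cosz l ^+ 2 - cosz n ^+ 2) / (cosz l + 1) ^+ 2)) =
  (1 - cosz n) / (2 * cosz n).
Proof.
rewrite (eq_bigr _ (fun i _ => cheb_termE n i)) -mulr_suml.
have := saal_sum n.
(* The term i = 0 is 1, so the rest [S] of the series is 1/T_n - 1. *)
rewrite -(big_mkord xpredT (fun i => \prod_(l < i) saalFactor n l)) big_nat_recl //=.
rewrite big_ord0 big_add1 /=; set S := \sum_(0 <= i < n) _ => e.
have -> : S = (1 - cosz n) / cosz n by rewrite -e; field; exact: cosz_neq0.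
by field; rewrite two_neq0 cosz_neq0.
Qed.

End NotRootOfUnity.

(** * Transfer to the field of rational functions *)

Lemma exists_reciprocal_root (K : fieldType) (x : K) :
  exists (L : fieldType) (f : {rmorphism K -> L}) (z : L),
    z ^+ 2 + 1 = 2 * f x * z.
Proof.
pose p : {poly K} := 'X^2 + 1 - (2 * x) *: 'X.
have size_p : size p = 3.
  rewrite /p -addrA size_polyDl size_polyXn //.
  rewrite (leq_ltn_trans (size_polyD _ _)) // gtn_max size_poly1 size_polyN.
  by rewrite (leq_ltn_trans (size_scale_leq _ _)) ?size_polyX.
(* Having a root is not decidable over an arbitrary field, hence the classical split; without a root
   the quadratic is irreducible and a root is adjoined. *)
have [[z rz]|no_root] := classic (exists z, root p z).
  exists K, idfun, z; apply/eqP; rewrite -subr_eq0 -(eqP rz) /p.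
  by rewrite !hornerE.
have irr_p : irreducible_poly p.
  apply: cubic_irreducible => [|z]; first by rewrite size_p.
  by apply/negP => rz; apply: no_root; exists z.
have [L _ [z rz _]] := irredp_FAdjoin irr_p.
exists L, (in_alg L), z; apply/eqP; rewrite -subr_eq0 -(eqP rz) /p.
rewrite rmorphB rmorphD /= map_polyZ map_polyXn rmorph1 map_polyX.
by rewrite !hornerE rmorphM rmorph_nat.
Qed.

Lemma size_chebyshevT (F : numFieldType) n :
  size (chebyshevT F n) = n.+1.
Proof.
suff [] : size (chebyshevT F n) = n.+1 /\ size (chebyshevT F n.+1) = n.+2 by [].
elim: n => [|n [IHn IHn1]]; first by rewrite size_poly1 size_polyX.
split=> //; have -> : chebyshevT F n.+2 = 2 *: ('X * chebyshevT F n.+1) - chebyshevT F n by [].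
have size2 : size ((2 : F) *: ('X * chebyshevT F n.+1)) = n.+3.
  rewrite size_scale ?pnatr_eq0 // mulrC size_mulX ?IHn1 //.
  by rewrite -size_poly_eq0 IHn1.
by rewrite size_polyDl size2 // size_polyN IHn.
Qed.

Theorem proposition3p4 (F : numFieldType) (n : nat) (hn : (1 <= n)%N) :
  \sum_(1 <= i < n.+1)
     2 ^+ i / (chebT F i + 1) *
     \prod_(0 <= l < i)
        (chebC F l i *
         ((chebT F l ^+ 2 - chebT F n ^+ 2) / (chebT F l + 1) ^+ 2))
  = (1 - chebT F n) / (2 * chebT F n).
Proof.
have [L [f [z zE]]] := exists_reciprocal_root (chebT F 1).
have two_neq0 : 2 != 0 :> L.
  rewrite -(rmorph_nat f) fmorph_eq0 -(rmorph_nat (@FracField.tofrac _)).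
  by rewrite tofrac_eq0 -polyC_natr polyC_eq0 pnatr_eq0.
have z_neq0 : z != 0.
  apply/eqP => z0; move: zE; rewrite z0 mulr0 expr0n add0r => /eqP.
  by rewrite oner_eq0.
have f1 : f (chebT F 1) = (z ^+ 2 + 1) / (2 * z).
  by rewrite zE; field; rewrite two_neq0 z_neq0.
have fE k : f (chebT F k) = cosz z k.
  suff [] : f (chebT F k) = cosz z k /\ f (chebT F k.+1) = cosz z k.+1 by [].
  elim: k => [|k [IHk IHk1]].
    split; last by rewrite f1 /cosz expr1; field; rewrite two_neq0 z_neq0.
    have -> : chebT F 0 = 1 by apply: rmorph1.
    by rewrite rmorph1 /cosz expr0; field; rewrite oner_neq0 two_neq0.
  split=> //; have -> : chebT F k.+2 = 2 * (chebT F 1 * chebT F k.+1) - chebT F k.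
    rewrite /chebT -[in RHS](rmorph_nat (@FracField.tofrac _)) -!rmorphM -rmorphB /=.
    by rewrite -mul_polyC polyC_natr.
  rewrite rmorphB !rmorphM rmorph_nat f1 IHk1 IHk /cosz !exprS.
  by field; rewrite two_neq0 z_neq0 expf_neq0.
(* If z^m = 1 then T_m = (1 + 1)/2 = 1, impossible for a polynomial of degree m > 0. *)
have z_not_unity m : (0 < m)%N -> z ^+ m != 1.
  move=> m_gt0; apply/eqP => zm1.
  have /eqP : f (chebT F m) = 1.
    by rewrite fE /cosz zm1; field; rewrite oner_neq0 two_neq0.
  rewrite fmorph_eq1 -(rmorph1 (@FracField.tofrac _)) tofrac_eq => /eqP T1.
  by have := size_chebyshevT F m; rewrite T1 size_poly1 => -[m0]; rewrite -m0 in m_gt0.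
(* A field morphism is injective, so the identity may be checked in [L], where x = (z + 1/z)/2. *)
apply: (fmorph_inj f); rewrite rmorph_sum /= fmorph_div rmorphB rmorphM rmorph1 rmorph_nat fE.
rewrite -(cosz_identity two_neq0 z_neq0 z_not_unity); apply: eq_bigr => i _.
rewrite rmorphM fmorph_div rmorphXn rmorph_nat rmorphD rmorph1 fE rmorph_prod.
congr (_ * _); apply: eq_bigr => l _; rewrite /chebC.
rewrite rmorphM !fmorph_div !(rmorphXn, rmorphM, rmorphB, rmorphD, rmorph1) /=.
by rewrite !fE.
Qed.
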